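(* Let $\mathbb{C}$ be a model structure on a finitely bicomplete preorder $\mathcal{C}$, and let $\mathcal{D}$ be the full subcategory of $\mathcal{C}$ on the objects that are both cofibrant and fibrant. Then $\mathbb{C}$ is Quillen equivalent to the model structure $\mathbb{D}$ on $\mathcal{D}$ given by $$\mathbb{D}_{we}=\mathrm{iso}\,\mathcal{D},\qquad \mathbb{D}_{cof}=\mathbb{D}_{fib}=\mathcal{D}.$$
   Context: All categories are assumed skeletal (isomorphic objects are equal), so a preorder here is a category with at most one morphism between any two objects in which isomorphic objects are equal. $\mathrm{iso}\,\mathcal{D}$ denotes the isomorphisms of $\mathcal{D}$. Lifting: for morphisms $f:A\to B$ and $g:X\to Y$, $f$ lifts on the left of $g$ if every commutative square from $f$ to $g$ (with top $A\to X$ and bottom $B\to Y$) admits a morphism $h:B\to X$ making the diagram commute. For a class $S$ of morphisms, $\mathrm{RLP}(S)$ is the class of morphisms $g$ such that every $f\in S$ lifts on the left of $g$, and $\mathrm{LLP}(S)$ is the class of morphisms $f$ that lift on the left of every $g\in S$. A weak factorization system (WFS) is a pair $(\mathcal{L},\mathcal{R})$ of classes of morphisms with $\mathcal{L}=\mathrm{LLP}(\mathcal{R})$, $\mathcal{R}=\mathrm{RLP}(\mathcal{L})$, such that every morphism factors as a morphism in $\mathcal{L}$ followed by a morphism in $\mathcal{R}$. A model structure $\mathbb{C}$ on a finitely bicomplete category $\mathcal{C}$ consists of three subcategories $\mathbb{C}_{we}$ (weak equivalences), $\mathbb{C}_{cof}$ (cofibrations), $\mathbb{C}_{fib}$ (fibrations)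 such that $(\mathbb{C}_{cof},\mathbb{C}_{fib}\cap\mathbb{C}_{we})$ and $(\mathbb{C}_{cof}\cap\mathbb{C}_{we},\mathbb{C}_{fib})$ are WFSs, and such that whenever two of $f$, $g$, $gf$ are in $\mathbb{C}_{we}$, so is the third. A is cofibrant if the morphism from the initial object to $A$ is a cofibration, and fibrant if the morphism from $A$ to the terminal object is a fibration. Acyclic (co)fibrations are (co)fibrations that are weak equivalences. An adjunction $F:\mathcal{C}\rightleftarrows\mathcal{D}:G$ ($F$ left adjoint) between categories with model structures $\mathbb{C},\mathbb{D}$ is a Quillen adjunction if $F$ preserves cofibrations and acyclic cofibrations and $G$ preserves fibrations and acyclic fibrations. It is a Quillen equivalence if moreover, whenever $A\in\mathcal{C}$ is cofibrant and $B\in\mathcal{D}$ is fibrant, a morphism $A\to G(B)$ is a weak equivalence if and only if its adjoint $F(A)\to B$ is a weak equivalence. Two model structures are Quillen equivalent if they are connected by a chain (zigzag) of Quillen equivalences. *)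

(* Defs.v *)
From Stdlib Require Import List FinFun Relation_Operators.

Set Implicit Arguments.
Unset Strict Implicit.
Unset Printing Implicit Defensive.

Declare Scope cat_scope.
Delimit Scope cat_scope with cat.

Record category : Type := Category {
  obj :> Type;
  Hom : obj -> obj -> Type;
  idm : forall A, Hom A A;
  comp : forall A B C, Hom B C -> Hom A B -> Hom A C;
  comp_idl : forall A B (f : Hom A B), comp (idm B) f = f;
  comp_idr : forall A B (f : Hom A B), comp f (idm A) = f;
  comp_assoc : forall A B C D (h : Hom C D) (g : Hom B C) (f : Hom A B),
    comp h (comp g f) = comp (comp h g) f
}.

Arguments Hom {c} A B : rename.
Arguments idm {c} A : rename.
Arguments comp {c A B C} g f : rename.

Notation "g ∘ f" := (comp g f) (at level 40, left associativity) : cat_scope.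
Local Open Scope cat_scope.

Definition is_iso (C : category) (A B : C) (f : Hom A B) : Prop :=
  exists g : Hom B A, g ∘ f = idm A /\ f ∘ g = idm B.

Definition thin (C : category) : Prop :=
  forall (A B : C) (f g : Hom A B), f = g.

Definition skeletal (C : category) : Prop :=
  forall (A B : C) (f : Hom A B), is_iso f -> A = B.

Record preorder (C : category) : Prop := Preorder {
  preorder_thin : thin C;
  preorder_skeletal : skeletal C
}.

Record functor (C D : category) : Type := Functor {
  fobj :> C -> D;
  fmap : forall A B : C, Hom A B -> Hom (fobj A) (fobj B);
  fmap_id : forall A : C, fmap (idm A) = idm (fobj A);
  fmap_comp : forall (A B E : C) (g : Hom B E) (f : Hom A B),
    fmap (g ∘ f) = fmap g ∘ fmap f
}.

Arguments fmap {C D} F {A B} f : rename.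

Definition full_subcategory (C : category) (P : C -> Prop) : category :=
  @Category {A : C | P A}
    (fun A B => Hom (proj1_sig A) (proj1_sig B))
    (fun A => idm (proj1_sig A))
    (fun _ _ _ g f => g ∘ f)
    (fun _ _ f => comp_idl f)
    (fun _ _ f => comp_idr f)
    (fun _ _ _ _ h g f => comp_assoc h g f).

Record adjunction (C D : category) (F : functor C D) (G : functor D C) : Type :=
  Adjunction {
  transpose : forall (A : C) (B : D), Hom (F A) B -> Hom A (G B);
  untranspose : forall (A : C) (B : D), Hom A (G B) -> Hom (F A) B;
  transposeK : forall (A : C) (B : D) (f : Hom (F A) B),
    untranspose (transpose f) = f;
  untransposeK : forall (A : C) (B : D) (f : Hom A (G B)),
    transpose (untranspose f) = f;
  transpose_natural : forall (A A' : C) (B B' : D)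
      (a : Hom A' A) (f : Hom (F A) B) (b : Hom B B'),
    transpose (b ∘ f ∘ fmap F a) = fmap G b ∘ transpose f ∘ a
}.

Definition finite_category (J : category) : Prop :=
  Finite J /\ forall A B : J, Finite (Hom A B).

Definition is_cone (J C : category) (X : functor J C) (L : C)
    (p : forall j, Hom L (X j)) : Prop :=
  forall (i j : J) (u : Hom i j), fmap X u ∘ p i = p j.

Definition is_limit (J C : category) (X : functor J C) (L : C)
    (p : forall j, Hom L (X j)) : Prop :=
  is_cone p /\
  forall (K : C) (q : forall j, Hom K (X j)), is_cone q ->
    exists! h : Hom K L, forall j, p j ∘ h = q j.

Definition is_cocone (J C : category) (X : functor J C) (L : C)
    (p : forall j, Hom (X j) L) : Prop :=
  forall (i j : J) (u : Hom i j), p j ∘ fmap X u = p i.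

Definition is_colimit (J C : category) (X : functor J C) (L : C)
    (p : forall j, Hom (X j) L) : Prop :=
  is_cocone p /\
  forall (K : C) (q : forall j, Hom (X j) K), is_cocone q ->
    exists! h : Hom L K, forall j, h ∘ p j = q j.

Definition finitely_bicomplete (C : category) : Prop :=
  forall (J : category), finite_category J -> forall X : functor J C,
    (exists (L : C) (p : forall j, Hom L (X j)), is_limit p) /\
    (exists (L : C) (p : forall j, Hom (X j) L), is_colimit p).

Definition is_initial (C : category) (I : C) : Prop :=
  forall A : C, exists! f : Hom I A, True.

Definition is_terminal (C : category) (T : C) : Prop :=
  forall A : C, exists! f : Hom A T, True.

Definition mor_class (C : category) : Type :=
  forall A B : C, Hom A B -> Prop.

Definition all_morphisms (C : category) : mor_class C := fun _ _ _ => True.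

Definition isomorphisms (C : category) : mor_class C :=
  fun _ _ f => is_iso f.

Definition mor_inter (C : category) (S T : mor_class C) : mor_class C :=
  fun A B f => S A B f /\ T A B f.

Definition lifts (C : category) (A B X Y : C) (f : Hom A B) (g : Hom X Y) :
    Prop :=
  forall (top : Hom A X) (bot : Hom B Y), g ∘ top = bot ∘ f ->
    exists h : Hom B X, h ∘ f = top /\ g ∘ h = bot.

Definition RLP (C : category) (S : mor_class C) : mor_class C :=
  fun X Y g => forall (A B : C) (f : Hom A B), S A B f -> lifts f g.

Definition LLP (C : category) (S : mor_class C) : mor_class C :=
  fun A B f => forall (X Y : C) (g : Hom X Y), S X Y g -> lifts f g.

Record is_WFS (C : category) (L R : mor_class C) : Prop := IsWFS {
  WFS_left : forall (A B : C) (f : Hom A B), L A B f <-> LLP R f;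
  WFS_right : forall (A B : C) (f : Hom A B), R A B f <-> RLP L f;
  WFS_factor : forall (A B : C) (f : Hom A B),
    exists (Z : C) (l : Hom A Z) (r : Hom Z B),
      L A Z l /\ R Z B r /\ r ∘ l = f
}.

(* Subcategories containing all objects; the factorization axioms below force
   this for the classes of a model structure anyway. *)
Record is_subcategory (C : category) (S : mor_class C) : Prop :=
  IsSubcategory {
  sub_id : forall A : C, S A A (idm A);
  sub_comp : forall (A B E : C) (g : Hom B E) (f : Hom A B),
    S A B f -> S B E g -> S A E (g ∘ f)
}.

Definition two_out_of_three (C : category) (W : mor_class C) : Prop :=
  forall (A B E : C) (f : Hom A B) (g : Hom B E),
    (W A B f -> W B E g -> W A E (g ∘ f)) /\
    (W A B f -> W A E (g ∘ f) -> W B E g) /\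
    (W B E g -> W A E (g ∘ f) -> W A B f).

Record is_model_structure (C : category) (we cof fib : mor_class C) : Prop :=
  IsModelStructure {
  ms_we_sub : is_subcategory we;
  ms_cof_sub : is_subcategory cof;
  ms_fib_sub : is_subcategory fib;
  ms_wfs_acyclic_fib : is_WFS cof (mor_inter fib we);
  ms_wfs_acyclic_cof : is_WFS (mor_inter cof we) fib;
  ms_two_out_of_three : two_out_of_three we
}.

Record model_structure (C : category) : Type := ModelStructure {
  weq : mor_class C;
  cof : mor_class C;
  fib : mor_class C;
  model_axioms : is_model_structure weq cof fib
}.

Arguments weq {C} M {A B} f : rename.
Arguments cof {C} M {A B} f : rename.
Arguments fib {C} M {A B} f : rename.

(* Initial and terminal objects are unique up to unique isomorphism, so the
   choice of [I] and [T] is immaterial. *)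
Definition cofibrant (C : category) (M : model_structure C) (A : C) : Prop :=
  exists (I : C) (f : Hom I A), is_initial I /\ cof M f.

Definition fibrant (C : category) (M : model_structure C) (A : C) : Prop :=
  exists (T : C) (f : Hom A T), is_terminal T /\ fib M f.

Definition bifibrant (C : category) (M : model_structure C) (A : C) : Prop :=
  cofibrant M A /\ fibrant M A.

Record quillen_adjunction (C D : category) (M : model_structure C)
    (N : model_structure D) (F : functor C D) (G : functor D C)
    (adj : adjunction F G) : Prop := QuillenAdjunction {
  quillen_cof : forall (A B : C) (f : Hom A B),
    cof M f -> cof N (fmap F f);
  quillen_acyclic_cof : forall (A B : C) (f : Hom A B),
    cof M f -> weq M f -> cof N (fmap F f) /\ weq N (fmap F f);
  quillen_fib : forall (A B : D) (f : Hom A B),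
    fib N f -> fib M (fmap G f);
  quillen_acyclic_fib : forall (A B : D) (f : Hom A B),
    fib N f -> weq N f -> fib M (fmap G f) /\ weq M (fmap G f)
}.

Record quillen_equivalence (C D : category) (M : model_structure C)
    (N : model_structure D) (F : functor C D) (G : functor D C)
    (adj : adjunction F G) : Prop := QuillenEquivalence {
  quillen_equivalence_adj : quillen_adjunction M N adj;
  quillen_equivalence_weq : forall (A : C) (B : D) (f : Hom A (G B)),
    cofibrant M A -> fibrant N B ->
    (weq M f <-> weq N (untranspose adj f))
}.

(* All categories are assumed skeletal, including the intermediate ones in a
   zigzag of Quillen equivalences. *)
Record model_category : Type := ModelCategory {
  mc_cat : category;
  mc_skeletal : skeletal mc_cat;
  mc_bicomplete : finitely_bicomplete mc_cat;
  mc_model : model_structure mc_cat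
}.

Definition quillen_equivalence_step (X Y : model_category) : Prop :=
  exists (F : functor (mc_cat X) (mc_cat Y))
         (G : functor (mc_cat Y) (mc_cat X)) (adj : adjunction F G),
    quillen_equivalence (mc_model X) (mc_model Y) adj.

Definition quillen_equivalent (X Y : model_category) : Prop :=
  clos_refl_sym_trans model_category quillen_equivalence_step X Y.

(* Main.v *)
(** In a preorder a retract is an equality, so the retract argument becomes very
    strong: every morphism into a cofibrant object is a cofibration and every
    morphism out of a fibrant object is a fibration.  Hence cofibrant
    replacement [Q] is right adjoint to the inclusion of the cofibrant objects,
    the model structure restricts to them, and this coreflection is a Quillen
    equivalence.  On cofibrant objects fibrant replacement [R] is left adjoint
    to the inclusion of the bifibrant ones, which gives a second Quillen
    equivalence; a weak equivalence between bifibrant objects is an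
    isomorphism. *)

From Stdlib Require Import Relation_Operators IndefiniteDescription
  ProofIrrelevance.
Require Import Defs.

Set Implicit Arguments.
Unset Strict Implicit.
Unset Printing Implicit Defensive.

Local Open Scope cat_scope.

(** * Thin categories, full subcategories and retracts *)

(** Lifts are only known to exist, whereas functors and adjunctions are data. Choice bridges the
    gap; in a thin category the chosen morphism is immaterial and all equations are automatic. *)
Definition some_of (T : Type) (H : inhabited T) : T :=
  proj1_sig (constructive_indefinite_description (fun _ : T => True)
               (match H with inhabits x => ex_intro _ x I end)).

Definition thin_functor (C D : category) (HD : thin D) (f : C -> D)
    (m : forall A B : C, Hom A B -> inhabited (Hom (f A) (f B))) :
    functor C D :=
  @Functor C D f (fun A B u => some_of (m A B u))
    (fun _ => HD _ _ _ _) (fun _ _ _ _ _ => HD _ _ _ _).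

Definition thin_adjunction (C D : category) (HC : thin C) (HD : thin D)
    (F : functor C D) (G : functor D C)
    (t : forall (A : C) (B : D), Hom (F A) B -> inhabited (Hom A (G B)))
    (u : forall (A : C) (B : D), Hom A (G B) -> inhabited (Hom (F A) B)) :
    adjunction F G :=
  @Adjunction C D F G (fun A B f => some_of (t A B f))
    (fun A B f => some_of (u A B f))
    (fun _ _ _ => HD _ _ _ _) (fun _ _ _ => HC _ _ _ _)
    (fun _ _ _ _ _ _ _ => HC _ _ _ _).

Lemma thin_iso (C : category) (HC : thin C) (A B : C) (f : Hom A B)
    (g : Hom B A) : is_iso f.
Proof. exists g; split; apply HC. Qed.

(** Skeletality turns an isomorphism into an endomorphism, and thinness turns that into an
    identity. *)
Lemma iso_in_subcategory (C : category) (HC : preorder C) (S : mor_class C)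
    (HS : is_subcategory S) (A B : C) (f : Hom A B) :
  is_iso f -> S A B f.
Proof.
  intros Hf; destruct (preorder_skeletal HC Hf).
  rewrite (preorder_thin HC f (idm A)); apply (sub_id HS).
Qed.

Lemma full_subcategory_thin (C : category) (HC : thin C) (P : C -> Prop) :
  thin (full_subcategory P).
Proof. intros A B f g; apply HC. Qed.

(** The isomorphism is already one in [C]; proof irrelevance then identifies the two membership
    proofs. *)
Lemma full_subcategory_skeletal (C : category) (HC : skeletal C)
    (P : C -> Prop) : skeletal (full_subcategory P).
Proof.
  intros [A HA] [B HB] f Hf; apply subset_eq_compat, (HC A B f), Hf.
Qed.

Definition inclusion (C : category) (P : C -> Prop) :
    functor (full_subcategory P) C :=
  @Functor (full_subcategory P) C (@proj1_sig C P) (fun _ _ f => f)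
    (fun _ => eq_refl) (fun _ _ _ _ _ => eq_refl).

Definition restrict_class (C : category) (P : C -> Prop) (S : mor_class C) :
    mor_class (full_subcategory P) :=
  fun A B f => S (proj1_sig A) (proj1_sig B) f.

Lemma restrict_subcategory (C : category) (P : C -> Prop) (S : mor_class C) :
  is_subcategory S -> is_subcategory (@restrict_class C P S).
Proof.
  intros HS; split.
  - intros A; apply (sub_id HS).
  - intros A B E g f; apply (sub_comp HS).
Qed.

(* The limit (colimit) of [X] in [D] is the image under [G] of that of [F X]. *)
Lemma retract_finitely_bicomplete (C D : category) (HC : thin C) (HD : thin D)
    (F : functor D C) (G : functor C D)
    (to : forall A, Hom A (G (F A))) (from : forall A, Hom (G (F A)) A) :
  finitely_bicomplete C -> finitely_bicomplete D.
Proof.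
  intros bC J HJ X.
  pose (FX := thin_functor HC (f := fun j : J => F (X j))
                (fun i j u => inhabits (fmap F (fmap X u)))).
  destruct (bC J HJ FX) as [[L [p [_ Hp]]] [K [q [_ Hq]]]].
  split.
  - exists (G L), (fun j => from (X j) ∘ fmap G (p j)); split.
    + intros i j u; apply HD.
    + intros A r _.
      destruct (Hp (F A) (fun j => fmap F (r j))) as [h _].
      { intros i j u; apply HC. }
      exists (fmap G h ∘ to A); split; intros; apply HD.
  - exists (G K), (fun j => fmap G (q j) ∘ to (X j)); split.
    + intros i j u; apply HD.
    + intros A r _.
      destruct (Hq (F A) (fun j => fmap F (r j))) as [h _].
      { intros i j u; apply HC. }
      exists (from A ∘ fmap G h); split; intros; apply HD.
Qed.

(** * Initial and terminal objects, from the empty diagram *)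

Definition empty_category : category :=
  @Category Empty_set (fun _ _ => unit) (fun _ => tt)
    (fun _ _ _ _ _ => tt)
    (fun A => match A with end) (fun A => match A with end)
    (fun A => match A with end).

Definition empty_functor (C : category) : functor empty_category C.
Proof.
  exists (fun A : Empty_set => match A with end)
    (fun A : Empty_set => match A with end); intros [].
Defined.

Lemma empty_category_finite : finite_category empty_category.
Proof. split; [exists nil; intros [] | intros []]. Qed.

Lemma initial_exists (C : category) :
  finitely_bicomplete C -> exists I : C, is_initial I.
Proof.
  intros bC.
  destruct (bC _ empty_category_finite (empty_functor C))
    as [_ [I [p [_ Hp]]]].
  exists I; intros A.
  destruct (Hp A (fun j : empty_category => match j with end)) as [h [_ Hh]].
  { intros []. }
  exists h; split; [exact Logic.I | intros h' _; apply Hh; intros []].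
Qed.

Lemma terminal_exists (C : category) :
  finitely_bicomplete C -> exists T : C, is_terminal T.
Proof.
  intros bC.
  destruct (bC _ empty_category_finite (empty_functor C))
    as [[T [p [_ Hp]]] _].
  exists T; intros A.
  destruct (Hp A (fun j : empty_category => match j with end)) as [h [_ Hh]].
  { intros []. }
  exists h; split; [exact Logic.I | intros h' _; apply Hh; intros []].
Qed.

(** * Isomorphisms and the trivial model structure *)

Lemma two_out_of_three_iso (C : category) :
  two_out_of_three (@isomorphisms C).
Proof.
  intros A B E f g; split; [|split].
  - intros [f' [f'f ff']] [g' [g'g gg']]; exists (f' ∘ g'); split.
    + rewrite <- comp_assoc, (comp_assoc g' g f), g'g, comp_idl; exact f'f.
    + rewrite <- comp_assoc, (comp_assoc f f' g'), ff', comp_idl; exact gg'.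
  - intros [f' [f'f ff']] [h [hgf gfh]]; exists (f ∘ h); split.
    (* Padding with [f ∘ f'] exposes [h ∘ (g ∘ f)], which cancels. *)
    + rewrite <- (comp_idr (f ∘ h ∘ g)), <- ff', comp_assoc.
      rewrite <- (comp_assoc (f ∘ h) g f), <- (comp_assoc f h), hgf, comp_idr.
      reflexivity.
    + rewrite comp_assoc; exact gfh.
  - intros [g' [g'g gg']] [h [hgf gfh]]; exists (h ∘ g); split.
    + rewrite <- comp_assoc; exact hgf.
    + rewrite <- (comp_idl (f ∘ (h ∘ g))), <- g'g, <- comp_assoc.
      rewrite (comp_assoc f h g), (comp_assoc g (f ∘ h) g).
      rewrite (comp_assoc g f h), gfh, comp_idl; reflexivity.
Qed.

Lemma lifts_iso_left (C : category) (A B X Y : C) (f : Hom A B)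
    (g : Hom X Y) : is_iso f -> lifts f g.
Proof.
  intros [f' [f'f ff']] t b sq; exists (t ∘ f'); split.
  - rewrite <- comp_assoc, f'f; apply comp_idr.
  - rewrite comp_assoc, sq, <- comp_assoc, ff'; apply comp_idr.
Qed.

Lemma lifts_iso_right (C : category) (A B X Y : C) (f : Hom A B)
    (g : Hom X Y) : is_iso g -> lifts f g.
Proof.
  intros [g' [g'g gg']] t b sq; exists (g' ∘ b); split.
  - rewrite <- comp_assoc, <- sq, comp_assoc, g'g; apply comp_idl.
  - rewrite comp_assoc, gg'; apply comp_idl.
Qed.

(** Put identities on the top and bottom of the square from [f] to itself; the diagonal is then a
    two-sided inverse. *)
Lemma lifts_self_iso (C : category) (A B : C) (f : Hom A B) :
  lifts f f -> is_iso f.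
Proof.
  intros H; destruct (H (idm A) (idm B)) as [h Hh].
  - now rewrite comp_idl, comp_idr.
  - exists h; exact Hh.
Qed.

Lemma is_iso_idm (C : category) (A : C) : is_iso (idm A).
Proof. exists (idm A); split; apply comp_idl. Qed.

(** The two factorization systems are (all, isomorphisms) and (isomorphisms, all). A morphism that
    lifts against everything lifts against itself, so it is invertible; factorizations use an
    identity as one factor. *)
Lemma trivial_model_structure (C : category) :
  is_model_structure (@isomorphisms C) (@all_morphisms C) (@all_morphisms C).
Proof.
  split.
  - split; [apply is_iso_idm |].
    intros A B E g f Hf Hg; apply (two_out_of_three_iso f g); assumption.
  - split; constructor.
  - split; constructor.
  - split.
    + intros A B f; split; [| constructor].
      intros _ X Y g [_ Hg]; apply lifts_iso_right, Hg.
    + intros A B f; split.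
      * intros [_ Hf] X Y g _; apply lifts_iso_right, Hf.
      * intros Hf; split; [constructor |].
        apply lifts_self_iso, Hf; constructor.
    + intros A B f; exists B, f, (idm B).
      repeat split; [apply is_iso_idm | apply comp_idl].
  - split.
    + intros A B f; split.
      * intros [_ Hf] X Y g _; apply lifts_iso_left, Hf.
      * intros Hf; split; [constructor |].
        apply lifts_self_iso, Hf; constructor.
    + intros A B f; split; [| constructor].
      intros _ X Y g [_ Hg]; apply lifts_iso_left, Hg.
    + intros A B f; exists A, (idm A), f.
      repeat split; [apply is_iso_idm | apply comp_idr].
  - apply two_out_of_three_iso.
Qed.

(** * Lifting and factorization in a model structure *)

Lemma iso_weq (C : category) (HC : preorder C) (M : model_structure C)
    (A B : C) (f : Hom A B) : is_iso f -> weq M f.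
Proof. apply (iso_in_subcategory HC (ms_we_sub (model_axioms M))). Qed.

Lemma iso_cof (C : category) (HC : preorder C) (M : model_structure C)
    (A B : C) (f : Hom A B) : is_iso f -> cof M f.
Proof. apply (iso_in_subcategory HC (ms_cof_sub (model_axioms M))). Qed.

Lemma iso_fib (C : category) (HC : preorder C) (M : model_structure C)
    (A B : C) (f : Hom A B) : is_iso f -> fib M f.
Proof. apply (iso_in_subcategory HC (ms_fib_sub (model_axioms M))). Qed.

Lemma lifts_acyclic_fib (C : category) (M : model_structure C) (A B X Y : C)
    (f : Hom A B) (g : Hom X Y) :
  cof M f -> fib M g -> weq M g -> lifts f g.
Proof.
  intros Hf Hg Wg.
  apply (WFS_left (ms_wfs_acyclic_fib (model_axioms M)) f); [exact Hf |].
  split; assumption.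
Qed.

Lemma lifts_acyclic_cof (C : category) (M : model_structure C) (A B X Y : C)
    (f : Hom A B) (g : Hom X Y) :
  cof M f -> weq M f -> fib M g -> lifts f g.
Proof.
  intros Hf Wf Hg.
  apply (WFS_right (ms_wfs_acyclic_cof (model_axioms M)) g); [exact Hg |].
  split; assumption.
Qed.

Lemma factor_acyclic_fib (C : category) (M : model_structure C) (A B : C)
    (f : Hom A B) :
  exists (Z : C) (l : Hom A Z) (r : Hom Z B),
    cof M l /\ fib M r /\ weq M r /\ r ∘ l = f.
Proof.
  destruct (WFS_factor (ms_wfs_acyclic_fib (model_axioms M)) f)
    as [Z [l [r [Hl [[Hr Wr] E]]]]].
  exists Z, l, r; auto.
Qed.

Lemma factor_acyclic_cof (C : category) (M : model_structure C) (A B : C)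
    (f : Hom A B) :
  exists (Z : C) (l : Hom A Z) (r : Hom Z B),
    cof M l /\ weq M l /\ fib M r /\ r ∘ l = f.
Proof.
  destruct (WFS_factor (ms_wfs_acyclic_cof (model_axioms M)) f)
    as [Z [l [r [[Hl Wl] [Hr E]]]]].
  exists Z, l, r; auto.
Qed.

(** Lift [I → A] against [g]: initiality supplies the top of the square and thinness its
    commutativity. So cofibrant objects cannot tell [X] from [Y]. *)
Lemma cofibrant_lift (C : category) (HC : thin C) (M : model_structure C)
    (A X Y : C) (g : Hom X Y) (f : Hom A Y) :
  cofibrant M A -> fib M g -> weq M g -> inhabited (Hom A X).
Proof.
  intros [I [i [HI Hi]]] Hg Wg.
  destruct (HI X) as [t _].
  destruct (lifts_acyclic_fib Hi Hg Wg (HC _ _ (g ∘ t) (f ∘ i))) as [h _].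
  exact (inhabits h).
Qed.

(** Dually, lift [f] against [X → T]; terminality supplies the bottom of the square. *)
Lemma fibrant_lift (C : category) (HC : thin C) (M : model_structure C)
    (A B X : C) (f : Hom A B) (g : Hom A X) :
  fibrant M X -> cof M f -> weq M f -> inhabited (Hom B X).
Proof.
  intros [T [p [HT Hp]]] Hf Wf.
  destruct (HT B) as [b _].
  destruct (lifts_acyclic_cof Hf Wf Hp (HC _ _ (p ∘ g) (b ∘ f))) as [h _].
  exact (inhabits h).
Qed.

(** Factor [f] as a cofibration followed by an acyclic fibration [r]. The identity of [B] lifts
    through [r], so [r] is invertible and hence itself a cofibration. *)
Lemma cof_to_cofibrant (C : category) (HC : preorder C)
    (M : model_structure C) (A B : C) (f : Hom A B) :
  cofibrant M B -> cof M f.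
Proof.
  intros HB.
  destruct (factor_acyclic_fib M f) as [Z [l [r [Hl [Hr [Wr <-]]]]]].
  destruct (cofibrant_lift (preorder_thin HC) (idm B) HB Hr Wr) as [h].
  apply (sub_comp (ms_cof_sub (model_axioms M)) Hl).
  exact (iso_cof HC M (thin_iso (preorder_thin HC) r h)).
Qed.

(** Dually, the identity of [A] extends along the acyclic cofibration [l], which is therefore
    invertible. *)
Lemma fib_from_fibrant (C : category) (HC : preorder C)
    (M : model_structure C) (A B : C) (f : Hom A B) :
  fibrant M A -> fib M f.
Proof.
  intros HA.
  destruct (factor_acyclic_cof M f) as [Z [l [r [Hl [Wl [Hr <-]]]]]].
  destruct (fibrant_lift (preorder_thin HC) (idm A) HA Hl Wl) as [h].
  apply (sub_comp (ms_fib_sub (model_axioms M))) with (2 := Hr).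
  exact (iso_fib HC M (thin_iso (preorder_thin HC) l h)).
Qed.

Lemma cofibrant_cof (C : category) (M : model_structure C) (A B : C)
    (f : Hom A B) : cof M f -> cofibrant M A -> cofibrant M B.
Proof.
  intros Hf [I [i [HI Hi]]]; exists I, (f ∘ i); split; [exact HI |].
  exact (sub_comp (ms_cof_sub (model_axioms M)) Hi Hf).
Qed.

(** Cofibrancy of [B] makes [f] an acyclic cofibration, and extending the identity of the fibrant
    [A] along it yields the inverse. *)
Lemma weq_bifibrant_iso (C : category) (HC : preorder C)
    (M : model_structure C) (A B : C) (f : Hom A B) :
  fibrant M A -> cofibrant M B -> weq M f -> is_iso f.
Proof.
  intros HA HB Wf.
  destruct (fibrant_lift (preorder_thin HC) (idm A) HA
              (cof_to_cofibrant HC f HB) Wf) as [h].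
  exact (thin_iso (preorder_thin HC) f h).
Qed.

(** * Cofibrant and fibrant replacement *)

(** [Q A] comes from factoring [I → A]. Functoriality lifts the composite [Q A → A → B] through the
    acyclic fibration [Q B → B]. *)
Lemma cofibrant_replacement (C : category) (HC : preorder C)
    (bC : finitely_bicomplete C) (M : model_structure C) :
  exists Q : functor C C, forall A : C, cofibrant M (Q A) /\
    exists r : Hom (Q A) A, fib M r /\ weq M r.
Proof.
  destruct (initial_exists bC) as [I HI].
  (* Choice picks only the object; the morphism [r] may stay existential, being unique between its
     endpoints. *)
  destruct (functional_choice (fun A Z : C => cofibrant M Z /\
    exists r : Hom Z A, fib M r /\ weq M r)) as [Q HQ].
  - intros A; destruct (HI A) as [i _].
    destruct (factor_acyclic_fib M i) as [Z [l [r [Hl [Hr [Wr _]]]]]].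
    exists Z; split; [exists I, l | exists r]; auto.
  - assert (m : forall A B, Hom A B -> inhabited (Hom (Q A) (Q B))).
    { intros A B f.
      destruct (HQ A) as [cA [rA _]]; destruct (HQ B) as [_ [rB [Hr Wr]]].
      exact (cofibrant_lift (preorder_thin HC) (f ∘ rA) cA Hr Wr). }
    exists (thin_functor (preorder_thin HC) m); exact HQ.
Qed.

(** Dually, [R A] comes from factoring [A → T], and [A → B → R B] extends along [A → R A]. *)
Lemma fibrant_replacement (C : category) (HC : preorder C)
    (bC : finitely_bicomplete C) (M : model_structure C) :
  exists R : functor C C, forall A : C, fibrant M (R A) /\
    exists l : Hom A (R A), cof M l /\ weq M l.
Proof.
  destruct (terminal_exists bC) as [T HT].
  destruct (functional_choice (fun A Z : C => fibrant M Z /\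
    exists l : Hom A Z, cof M l /\ weq M l)) as [R HR].
  - intros A; destruct (HT A) as [p _].
    destruct (factor_acyclic_cof M p) as [Z [l [r [Hl [Wl [Hr _]]]]]].
    exists Z; split; [exists T, r | exists l]; auto.
  - assert (m : forall A B, Hom A B -> inhabited (Hom (R A) (R B))).
    { intros A B f.
      destruct (HR A) as [_ [lA [Hl Wl]]]; destruct (HR B) as [fB [lB _]].
      exact (fibrant_lift (preorder_thin HC) (lB ∘ f) fB Hl Wl). }
    exists (thin_functor (preorder_thin HC) m); exact HR.
Qed.

(** * The model structure on the cofibrant objects *)

(** All morphisms are cofibrations here, so the first factorization system is (all, isomorphisms).
    Factorizations of the second stay among cofibrant objects; as lifting is now tested only there,
    a retract argument recovers its classes. *)
Lemma cofibrant_model_axioms (C : category) (HC : preorder C)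
    (M : model_structure C) :
  is_model_structure (@restrict_class C (cofibrant M) (@weq C M))
    (@restrict_class C (cofibrant M) (@cof C M))
    (@restrict_class C (cofibrant M) (@fib C M)).
Proof.
  pose proof (preorder_thin HC) as tC.
  pose proof (full_subcategory_thin tC (P := cofibrant M)) as tCc.
  pose proof (model_axioms M) as ax.
  assert (Hcof : forall (A B : full_subcategory (cofibrant M))
                   (f : Hom A B), restrict_class (@cof C M) f).
  { intros A [B HB] f; exact (cof_to_cofibrant HC (f : @Hom C _ _) HB). }
  assert (Hfactor : forall (A B : full_subcategory (cofibrant M))
                      (f : Hom A B),
    exists (Z : full_subcategory (cofibrant M)) (l : Hom A Z) (r : Hom Z B),
      restrict_class (@weq C M) l /\ restrict_class (@fib C M) r).
  { intros [A HA] [B HB] f.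
    (* [l] is a cofibration out of a cofibrant object, so [Z] is cofibrant. *)
    destruct (factor_acyclic_cof M (f : @Hom C _ _))
      as [Z [l [r [Hl [Wl [Hr _]]]]]].
    exists (exist _ Z (cofibrant_cof Hl HA)), l, r; split; assumption. }
  split.
  - exact (restrict_subcategory _ (ms_we_sub ax)).
  - exact (restrict_subcategory _ (ms_cof_sub ax)).
  - exact (restrict_subcategory _ (ms_fib_sub ax)).
  - split.
    + intros A B f; split; [| intros; apply Hcof].
      intros Hf X Y g [Hg Wg]; exact (lifts_acyclic_fib Hf Hg Wg).
    + intros X Y g; split.
      * intros [Hg Wg] A B f Hf; exact (lifts_acyclic_fib Hf Hg Wg).
      (* [g] is itself a cofibration, so it lifts against itself. *)
      * intros Hg; pose proof (lifts_self_iso (Hg _ _ g (Hcof _ _ g))) as Ig.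
        split; [exact (iso_fib HC M Ig) | exact (iso_weq HC M Ig)].
    + intros A B f; exists B, f, (idm B); split; [apply Hcof |].
      split; [split | apply comp_idl].
      * exact (iso_fib HC M (is_iso_idm _)).
      * exact (iso_weq HC M (is_iso_idm _)).
  - split.
    + intros A B f; split.
      * intros [Hf Wf] X Y g Hg; exact (lifts_acyclic_cof Hf Wf Hg).
      * intros Hf; split; [apply Hcof |].
        (* Lifting [f] against its own factor [r] inverts [r], so [f] is a weak equivalence like
           [l]. *)
        destruct (Hfactor _ _ f) as [Z [l [r [Wl Hr]]]].
        destruct (Hf _ _ r Hr l (idm B) (tCc _ _ _ _)) as [h _].
        rewrite (tCc _ _ f (r ∘ l)).
        apply (ms_two_out_of_three ax); [exact Wl |].
        exact (iso_weq HC M (thin_iso tCc r h)).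
    + intros X Y g; split.
      * intros Hg A B f [Hf Wf]; exact (lifts_acyclic_cof Hf Wf Hg).
      * intros Hg.
        (* Dually, lifting [l] against [g] inverts [l], so [g] is a fibration like [r]. *)
        destruct (Hfactor _ _ g) as [Z [l [r [Wl Hr]]]].
        destruct (Hg _ _ l (conj (Hcof _ _ l) Wl) (idm X) r (tCc _ _ _ _))
          as [h _].
        rewrite (tCc _ _ g (r ∘ l)).
        apply (sub_comp (ms_fib_sub ax)); [| exact Hr].
        exact (iso_fib HC M (thin_iso tCc l h)).
    + intros A B f; destruct (Hfactor _ _ f) as [Z [l [r [Wl Hr]]]].
      exists Z, l, r; split; [split; [apply Hcof | exact Wl] |].
      split; [exact Hr | apply tCc].
  - intros A B E f g; exact (ms_two_out_of_three ax f g).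
Qed.

Definition cofibrant_model (C : category) (HC : preorder C)
    (M : model_structure C) : model_structure (full_subcategory (cofibrant M)) :=
  ModelStructure (cofibrant_model_axioms HC M).

(** * Finite bicompleteness of the two subcategories *)

(** [Q] retracts [C] onto the cofibrant objects: the identity of such an [A] lifts through
    [Q A → A]. *)
Lemma cofibrant_finitely_bicomplete (C : category) (HC : preorder C)
    (bC : finitely_bicomplete C) (M : model_structure C) :
  finitely_bicomplete (full_subcategory (cofibrant M)).
Proof.
  pose proof (preorder_thin HC) as tC.
  pose proof (full_subcategory_thin tC (P := cofibrant M)) as tCc.
  destruct (cofibrant_replacement HC bC M) as [Q HQ].
  pose (Qc := thin_functor tCc
    (f := fun A => exist (cofibrant M) (Q A) (proj1 (HQ A)))
    (fun A B u => inhabits (fmap Q u))).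
  apply (@retract_finitely_bicomplete C _ tC tCc
           (@inclusion C (cofibrant M)) Qc); [| | exact bC].
  - intros [A HA]; apply some_of.
    destruct (HQ A) as [_ [r [Hr Wr]]].
    exact (cofibrant_lift tC (idm A) HA Hr Wr).
  - intros [A HA]; apply some_of.
    destruct (HQ A) as [_ [r _]]; exact (inhabits r).
Qed.

(** The retraction is now [R] after [Q]; [R (Q A)] stays cofibrant because [Q A → R (Q A)] is a
    cofibration. *)
Lemma bifibrant_finitely_bicomplete (C : category) (HC : preorder C)
    (bC : finitely_bicomplete C) (M : model_structure C) :
  finitely_bicomplete (full_subcategory (bifibrant M)).
Proof.
  pose proof (preorder_thin HC) as tC.
  pose proof (full_subcategory_thin tC (P := bifibrant M)) as tD.
  destruct (cofibrant_replacement HC bC M) as [Q HQ].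
  destruct (fibrant_replacement HC bC M) as [R HR].
  assert (HRQ : forall A, bifibrant M (R (Q A))).
  { intros A; destruct (HQ A) as [cA _].
    destruct (HR (Q A)) as [fA [l [Hl _]]].
    split; [exact (cofibrant_cof Hl cA) | exact fA]. }
  pose (G := thin_functor tD
    (f := fun A => exist (bifibrant M) (R (Q A)) (HRQ A))
    (fun A B u => inhabits (fmap R (fmap Q u)))).
  apply (@retract_finitely_bicomplete C _ tC tD
           (@inclusion C (bifibrant M)) G); [| | exact bC].
  - intros [A [cA fA]]; apply some_of.
    destruct (HQ A) as [_ [r [Hr Wr]]]; destruct (HR (Q A)) as [_ [l _]].
    destruct (cofibrant_lift tC (idm A) cA Hr Wr) as [h].
    exact (inhabits (l ∘ h)).
  - intros [A [cA fA]]; apply some_of.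
    destruct (HQ A) as [_ [r _]]; destruct (HR (Q A)) as [_ [l [Hl Wl]]].
    (* As [A] is fibrant, [Q A → A] extends along [Q A → R (Q A)]. *)
    exact (fibrant_lift tC r fA Hl Wl).
Qed.

(** * The two Quillen equivalences *)

(** The inclusion is left adjoint to [Q], since maps from a cofibrant object to [B] lift through
    [Q B → B]. *)
Lemma cofibrant_quillen_equivalence (C : category) (HC : preorder C)
    (bC : finitely_bicomplete C) (M : model_structure C) :
  exists (F : functor (full_subcategory (cofibrant M)) C)
         (G : functor C (full_subcategory (cofibrant M)))
         (adj : adjunction F G),
    quillen_equivalence (cofibrant_model HC M) M adj.
Proof.
  pose proof (preorder_thin HC) as tC.
  pose proof (full_subcategory_thin tC (P := cofibrant M)) as tCc.
  pose proof (model_axioms M) as ax.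
  pose proof (model_axioms (cofibrant_model HC M)) as axc.
  destruct (cofibrant_replacement HC bC M) as [Q HQ].
  pose (Qc := thin_functor tCc
    (f := fun A => exist (cofibrant M) (Q A) (proj1 (HQ A)))
    (fun A B u => inhabits (fmap Q u))).
  assert (t : forall (A : full_subcategory (cofibrant M)) (B : C),
             Hom (@inclusion C (cofibrant M) A) B -> inhabited (Hom A (Qc B))).
  { intros [A HA] B f; destruct (HQ B) as [_ [r [Hr Wr]]].
    exact (cofibrant_lift tC (f : @Hom C _ _) HA Hr Wr). }
  assert (u : forall (A : full_subcategory (cofibrant M)) (B : C),
             Hom A (Qc B) -> inhabited (Hom (@inclusion C (cofibrant M) A) B)).
  { intros [A HA] B f; destruct (HQ B) as [_ [r _]].
    exact (inhabits (r ∘ (f : @Hom C A (Q B)))). }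
  pose (adj := thin_adjunction tCc tC t u).
  exists (@inclusion C (cofibrant M)), Qc, adj.
  (* Lifting problems against [fmap Qc g] transpose to ones against [g]. *)
  assert (Hlift : forall (A B : full_subcategory (cofibrant M)) (f : Hom A B)
      (X Y : C) (g : Hom X Y),
      @lifts C _ _ _ _ f g -> lifts f (fmap Qc g)).
  { intros A B f X Y g Hl top bot _.
    destruct (u _ _ top) as [t']; destruct (u _ _ bot) as [b'].
    destruct (Hl t' b' (tC _ _ _ _)) as [h _].
    destruct (t B X h) as [h']; exists h'; split; apply tCc. }
  split.
  - split.
    + intros A B f Hf; exact Hf.
    + intros A B f Hf Wf; split; assumption.
    (* Fibrations are characterized by lifting, and [Hlift] moves the lifting problems to [C]. *)
    + intros X Y g Hg; apply (WFS_right (ms_wfs_acyclic_cof axc)).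
      intros A B f [Hf Wf]; apply Hlift.
      exact (@lifts_acyclic_cof C M _ _ _ _ f g Hf Wf Hg).
    + intros X Y g Hg Wg; apply (WFS_right (ms_wfs_acyclic_fib axc)).
      intros A B f Hf; apply Hlift.
      exact (@lifts_acyclic_fib C M _ _ _ _ f g Hf Hg Wg).
  (* By thinness the adjunct of [f] is [r ∘ f] with [r] a weak equivalence, so two-out-of-three
     applies. *)
  - intros A B f _ _; destruct (HQ B) as [_ [r [_ Wr]]].
    set (g := untranspose adj f : @Hom C (proj1_sig A) B).
    rewrite (tC _ _ g (r ∘ (f : @Hom C (proj1_sig A) (Q B)))).
    destruct (ms_two_out_of_three ax (f : @Hom C (proj1_sig A) (Q B)) r)
      as [H1 [_ H2]].
    split; [intros Wf; exact (H1 Wf Wr) | intros Wrf; exact (H2 Wr Wrf)].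
Qed.

(** [R] is left adjoint to the inclusion, since maps from [A] to a fibrant object extend along the
    acyclic cofibration [A → R A]. *)
Lemma bifibrant_quillen_equivalence (C : category) (HC : preorder C)
    (bC : finitely_bicomplete C) (M : model_structure C) :
  exists (F : functor (full_subcategory (cofibrant M))
                (full_subcategory (bifibrant M)))
         (G : functor (full_subcategory (bifibrant M))
                (full_subcategory (cofibrant M)))
         (adj : adjunction F G),
    quillen_equivalence (cofibrant_model HC M)
      (ModelStructure (trivial_model_structure
                         (full_subcategory (bifibrant M)))) adj.
Proof.
  pose proof (preorder_thin HC) as tC.
  pose proof (full_subcategory_thin tC (P := cofibrant M)) as tCc.
  pose proof (full_subcategory_thin tC (P := bifibrant M)) as tD.
  pose proof (model_axioms M) as ax.
  destruct (fibrant_replacement HC bC M) as [R HR].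
  assert (HRc : forall A, cofibrant M A -> bifibrant M (R A)).
  { intros A cA; destruct (HR A) as [fA [l [Hl _]]].
    split; [exact (cofibrant_cof Hl cA) | exact fA]. }
  (* This lets weak equivalences of the trivial structure be tested in [M]. *)
  assert (Hweq : forall (A B : full_subcategory (bifibrant M)) (f : Hom A B),
             @weq C M _ _ f <-> is_iso f).
  { intros [A [cA fA]] [B [cB fB]] f; split.
    - intros Wf; exact (weq_bifibrant_iso HC fA cB Wf).
    - intros If; exact (iso_weq HC M If). }
  pose (F := thin_functor (C := full_subcategory (cofibrant M)) tD
    (f := fun A => exist (bifibrant M) (R (proj1_sig A))
                     (HRc _ (proj2_sig A)))
    (fun A B u => inhabits (fmap R (u : @Hom C _ _)))).
  pose (G := thin_functor (C := full_subcategory (bifibrant M)) tCc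
    (f := fun B => exist (cofibrant M) (proj1_sig B) (proj1 (proj2_sig B)))
    (fun A B u => inhabits (u : @Hom C _ _))).
  assert (t : forall A B, Hom (F A) B -> inhabited (Hom A (G B))).
  { intros [A cA] B f; destruct (HR A) as [_ [l _]].
    exact (inhabits ((f : @Hom C (R A) _) ∘ l)). }
  assert (u : forall A B, Hom A (G B) -> inhabited (Hom (F A) B)).
  { intros [A cA] [B [cB fB]] f; destruct (HR A) as [_ [l [Hl Wl]]].
    exact (fibrant_lift tC (f : @Hom C A B) fB Hl Wl). }
  pose (adj := thin_adjunction tCc tD t u).
  exists F, G, adj.
  split.
  - split.
    + constructor.
    + intros [A cA] [B cB] f _ Wf; split; [constructor |].
      apply Hweq.
      destruct (HR A) as [_ [lA [_ WA]]]; destruct (HR B) as [_ [lB [_ WB]]].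
      (* Two-out-of-three in the square [fmap F f ∘ lA = lB ∘ f]. *)
      apply (ms_two_out_of_three ax lA); [exact WA |].
      rewrite (tC _ _ _ (lB ∘ (f : @Hom C A B))).
      exact (proj1 (ms_two_out_of_three ax (f : @Hom C A B) lB) Wf WB).
    + intros [A [cA fA]] B f _; exact (fib_from_fibrant HC _ fA).
    + intros [A [cA fA]] B f _ If; split.
      * exact (fib_from_fibrant HC _ fA).
      * destruct If as [g _].
        exact (iso_weq HC M
                 (thin_iso tC (fmap G f : @Hom C A _) (g : @Hom C _ A))).
  - intros [A cA] B f _ _; destruct (HR A) as [_ [l [_ Wl]]].
    set (g := untranspose adj f : @Hom C (R A) (proj1_sig B)).
    destruct (ms_two_out_of_three ax l g) as [H1 [H2 _]].
    (* Thinness gives [f = g ∘ l] with [l] a weak equivalence, so [f] is one exactly when [g] is,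
       and by [Hweq] exactly when [g] is invertible. *)
    rewrite <- (tC _ _ (g ∘ l) f) in *.
    split.
    + intros Wf; apply (Hweq (F (exist _ A cA)) B), H2; assumption.
    + intros Ig; apply H1; [exact Wl |].
      apply (Hweq (F (exist _ A cA)) B), Ig.
Qed.

Theorem theorem5p4 (C : category) (HC : preorder C)
    (bC : finitely_bicomplete C) (M : model_structure C) :
  let D := full_subcategory (bifibrant M) in
  exists (sD : skeletal D) (bD : finitely_bicomplete D)
    (axD : is_model_structure (@isomorphisms D) (@all_morphisms D)
             (@all_morphisms D)),
    quillen_equivalent
      (ModelCategory (preorder_skeletal HC) bC M)
      (ModelCategory sD bD (ModelStructure axD)).
Proof.
  intros D.
  exists (full_subcategory_skeletal (preorder_skeletal HC) (P := bifibrant M)).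
  exists (bifibrant_finitely_bicomplete HC bC (M := M)).
  exists (trivial_model_structure D).
  pose (X := ModelCategory
    (full_subcategory_skeletal (preorder_skeletal HC) (P := cofibrant M))
    (cofibrant_finitely_bicomplete HC bC (M := M)) (cofibrant_model HC M)).
  apply rst_trans with X.
  (* Steps point along left adjoints, and here that is the inclusion of [X] into [C]; hence the
     symmetry. *)
  - apply rst_sym, rst_step; exact (cofibrant_quillen_equivalence HC bC M).
  - apply rst_step; exact (bifibrant_quillen_equivalence HC bC M).
Qed.
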